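(* Every countable ultrahomogeneous structure $\mathcal{A}$ (in a computable language) is relatively $\Delta^0_2$ categorical; that is, for every structure $\mathcal{B}$ isomorphic to $\mathcal{A}$ there is an isomorphism from $\mathcal{A}$ to $\mathcal{B}$ which is $\Delta^0_2$ relative to the atomic diagrams of $\mathcal{A}$ and $\mathcal{B}$.
   Context: Structures are countable, with universe a subset of $\omega$. A structure $\mathcal{A}$ is ultrahomogeneous if every isomorphism between finitely generated substructures of $\mathcal{A}$ extends to an automorphism of $\mathcal{A}$. An arbitrary (not necessarily computable) structure $\mathcal{A}$ is relatively $\Delta^0_2$ categorical if for every structure $\mathcal{B}$ isomorphic to $\mathcal{A}$ there is an isomorphism which is $\Delta^0_2$ relative to the (atomic) diagrams of $\mathcal{A}$ and $\mathcal{B}$, i.e. computable from the Turing jump of the join of the two diagrams. *)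

(* Defs.v *)
From Stdlib Require Import Arith List Cantor.

(** * Oracle computability

    Partial recursive functions relative to an oracle [X], as unary partial
    functions on [nat]; several arguments are passed through the Cantor
    pairing. *)

Definition pair_num (x y : nat) : nat := Cantor.to_nat (x, y).

Inductive code : Type :=
| Const (k : nat)
| Succ
| Fst
| Snd
| Query
| Pair (f g : code)
| Comp (f g : code)
| Prec (f g : code)
| Mu (f : code).

(** [eval X c n y] : the program [c] with oracle [X] halts on input [n] with
    output [y].
    - [Prec f g] sends (a, 0) to f(a), and (a, k+1) to g(a, (k, z)) where z is
      its value at (a, k).
    - [Mu f] sends n to the least y with f(n, y) = 0, provided f(n, j) is
      defined for all j < y. *)
Fixpoint eval (X : nat -> Prop) (c : code) (n y : nat) {struct c} : Prop :=
  match c with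
  | Const k => y = k
  | Succ => y = S n
  | Fst => y = fst (Cantor.of_nat n)
  | Snd => y = snd (Cantor.of_nat n)
  | Query => (X n /\ y = 1) \/ (~ X n /\ y = 0)
  | Pair f g => exists a b, eval X f n a /\ eval X g n b /\ y = pair_num a b
  | Comp f g => exists a, eval X g n a /\ eval X f a y
  | Prec f g =>
      let a := fst (Cantor.of_nat n) in
      nat_rect (fun _ => nat -> Prop)
        (eval X f a)
        (fun k value_at_k v =>
           exists z, value_at_k z /\ eval X g (pair_num a (pair_num k z)) v)
        (snd (Cantor.of_nat n)) y
  | Mu f =>
      eval X f (pair_num n y) 0 /\
      forall j, j < y -> exists z, eval X f (pair_num n j) (S z)
  end.

(** A partial function is given by its graph; the program must diverge exactly
    off the domain. *)
Definition partial_computable_in (X : nat -> Prop) (R : nat -> nat -> Prop) : Prop :=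
  exists c, forall n y, eval X c n y <-> R n y.

Definition computable (f : nat -> nat) : Prop :=
  partial_computable_in (fun _ => False) (fun n y => y = f n).

Fixpoint code_num (c : code) : nat :=
  match c with
  | Const k => pair_num 0 k
  | Succ => pair_num 1 0
  | Fst => pair_num 2 0
  | Snd => pair_num 3 0
  | Query => pair_num 4 0
  | Pair f g => pair_num 5 (pair_num (code_num f) (code_num g))
  | Comp f g => pair_num 6 (pair_num (code_num f) (code_num g))
  | Prec f g => pair_num 7 (pair_num (code_num f) (code_num g))
  | Mu f => pair_num 8 (code_num f)
  end.

(** A number [e] which is not the index of a program is taken to index the
    nowhere defined function. *)
Definition jump (X : nat -> Prop) (e : nat) : Prop :=
  exists c y, code_num c = e /\ eval X c e y.

Definition join (X Y : nat -> Prop) (n : nat) : Prop :=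
  if Nat.even n then X (Nat.div2 n) else Y (Nat.div2 n).

(** * Languages and structures *)

(** Symbols are natural numbers, [None] meaning that the number is not a
    symbol of that kind; constants are function symbols of arity 0. *)
Record language : Type := {
  rel_arity : nat -> option nat;
  fun_arity : nat -> option nat
}.

Definition arity_num (o : option nat) : nat :=
  match o with None => 0 | Some k => S k end.

Definition computable_language (L : language) : Prop :=
  computable (fun s => arity_num (rel_arity L s)) /\
  computable (fun s => arity_num (fun_arity L s)).

(** The values of [rel_interp] and [fun_interp] at non-symbols, at lists of the
    wrong length, or at lists not contained in the universe are irrelevant. *)
Record structure (L : language) : Type := {
  universe : nat -> Prop;
  rel_interp : nat -> list nat -> Prop;
  fun_interp : nat -> list nat -> nat;
  fun_interp_closed : forall s args,
    fun_arity L s = Some (length args) -> Forall universe args ->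
    universe (fun_interp s args)
}.

Arguments universe {L} _ _.
Arguments rel_interp {L} _ _ _.
Arguments fun_interp {L} _ _ _.
Arguments fun_interp_closed {L} _ _ _ _ _.

(** Only the restriction of [f] to the universe of [A] matters. *)
Record isomorphism {L : language} (A B : structure L) (f : nat -> nat) : Prop := {
  iso_maps : forall a, universe A a -> universe B (f a);
  iso_inj : forall a a', universe A a -> universe A a' -> f a = f a' -> a = a';
  iso_surj : forall b, universe B b -> exists a, universe A a /\ f a = b;
  iso_fun : forall s args,
    fun_arity L s = Some (length args) -> Forall (universe A) args ->
    f (fun_interp A s args) = fun_interp B s (map f args);
  iso_rel : forall s args,
    rel_arity L s = Some (length args) -> Forall (universe A) args ->
    (rel_interp A s args <-> rel_interp B s (map f args))
}.

Definition isomorphic {L : language} (A B : structure L) : Prop :=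
  exists f, isomorphism A B f.

Record substructure {L : language} (S A : structure L) : Prop := {
  sub_universe : forall a, universe S a -> universe A a;
  sub_fun : forall s args,
    fun_arity L s = Some (length args) -> Forall (universe S) args ->
    fun_interp S s args = fun_interp A s args;
  sub_rel : forall s args,
    rel_arity L s = Some (length args) -> Forall (universe S) args ->
    (rel_interp S s args <-> rel_interp A s args)
}.

Definition finitely_generated {L : language} (S : structure L) : Prop :=
  exists gens : list nat,
    Forall (universe S) gens /\
    forall T : structure L, substructure T S -> Forall (universe T) gens ->
      forall a, universe S a -> universe T a.

Definition ultrahomogeneous {L : language} (A : structure L) : Prop :=
  forall (S T : structure L) (f : nat -> nat),
    substructure S A -> substructure T A ->
    finitely_generated S -> finitely_generated T ->
    isomorphism S T f ->
    exists g, isomorphism A A g /\ forall a, universe S a -> g a = f a.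

(** * Atomic diagrams *)

(** Closed terms in which natural numbers name elements of a structure. *)
Inductive term : Type :=
| Elt (a : nat)
| App (s : nat) (ts : list term).

Inductive atomic : Type :=
| Eq (t u : term)
| Rel (s : nat) (ts : list term).

Inductive literal : Type :=
| Pos (p : atomic)
| Neg (p : atomic).

Inductive wf_term {L : language} (A : structure L) : term -> Prop :=
| wf_Elt a : universe A a -> wf_term A (Elt a)
| wf_App s ts :
    fun_arity L s = Some (length ts) -> (forall t, In t ts -> wf_term A t) ->
    wf_term A (App s ts).

Definition wf_atomic {L : language} (A : structure L) (p : atomic) : Prop :=
  match p with
  | Eq t u => wf_term A t /\ wf_term A u
  | Rel s ts => rel_arity L s = Some (length ts) /\ Forall (wf_term A) ts
  end.

Definition wf_literal {L : language} (A : structure L) (l : literal) : Prop :=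
  match l with Pos p | Neg p => wf_atomic A p end.

Fixpoint term_value {L : language} (A : structure L) (t : term) : nat :=
  match t with
  | Elt a => a
  | App s ts => fun_interp A s (map (term_value A) ts)
  end.

Definition atomic_true {L : language} (A : structure L) (p : atomic) : Prop :=
  match p with
  | Eq t u => term_value A t = term_value A u
  | Rel s ts => rel_interp A s (map (term_value A) ts)
  end.

Definition literal_true {L : language} (A : structure L) (l : literal) : Prop :=
  match l with
  | Pos p => atomic_true A p
  | Neg p => ~ atomic_true A p
  end.

Definition list_num (l : list nat) : nat :=
  fold_right (fun x r => S (pair_num x r)) 0 l.

Fixpoint term_num (t : term) : nat :=
  match t with
  | Elt a => pair_num 0 a
  | App s ts => pair_num 1 (pair_num s (list_num (map term_num ts)))
  end.

Definition atomic_num (p : atomic) : nat :=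
  match p with
  | Eq t u => pair_num 0 (pair_num (term_num t) (term_num u))
  | Rel s ts => pair_num 1 (pair_num s (list_num (map term_num ts)))
  end.

Definition literal_num (l : literal) : nat :=
  match l with
  | Pos p => pair_num 0 (atomic_num p)
  | Neg p => pair_num 1 (atomic_num p)
  end.

(** The atomic and negated atomic sentences, with names for the elements of
    [A], which hold in [A]. *)
Definition atomic_diagram {L : language} (A : structure L) (n : nat) : Prop :=
  exists l, literal_num l = n /\ wf_literal A l /\ literal_true A l.

Lemma pair_num_inj x y x' y' :
  pair_num x y = pair_num x' y' -> x = x' /\ y = y'.
Proof.
  intros H. apply (Cantor.to_nat_inj (x, y) (x', y')) in H. injection H. auto.
Qed.

Ltac pair_num_inj :=
  repeat match goal with
  | H : pair_num _ _ = pair_num _ _ |- _ =>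
      apply pair_num_inj in H; destruct H
  end.

Lemma code_num_inj c d : code_num c = code_num d -> c = d.
Proof.
  revert d.
  induction c; intros d H; destruct d; simpl in H; pair_num_inj;
    try discriminate; f_equal; auto.
Qed.

Lemma list_num_map_inj (T : Type) (num : T -> nat) (l m : list T) :
  (forall x, In x l -> forall y, num x = num y -> x = y) ->
  list_num (map num l) = list_num (map num m) -> l = m.
Proof.
  revert m. induction l as [|x l IH]; intros [|y m] Hinj H; simpl in H;
    try discriminate; auto.
  injection H as H. pair_num_inj. f_equal.
  - apply Hinj; simpl; auto.
  - apply IH; auto. intros z Hz. apply Hinj. simpl; auto.
Qed.

Fixpoint term_num_inj (t : term) : forall u, term_num t = term_num u -> t = u.
Proof.
  destruct t as [a|s ts]; intros [b|r us] H; simpl in H; pair_num_inj;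
    try discriminate; f_equal; auto.
  refine (list_num_map_inj _ _ _ _ _ H1).
  clear - term_num_inj.
  induction ts as [|t ts IH]; intros x Hx; simpl in Hx.
  - destruct Hx.
  - destruct Hx as [<- | Hx]; [exact (term_num_inj t) | exact (IH x Hx)].
Qed.

Lemma atomic_num_inj p q : atomic_num p = atomic_num q -> p = q.
Proof.
  destruct p, q; simpl; intros H; pair_num_inj; try discriminate;
    f_equal; auto using term_num_inj.
  eapply list_num_map_inj; eauto using term_num_inj.
Qed.

Lemma literal_num_inj l m : literal_num l = literal_num m -> l = m.
Proof.
  destruct l, m; simpl; intros H; pair_num_inj; try discriminate;
    f_equal; auto using atomic_num_inj.
Qed.

(** * Relative categoricity *)

Definition delta02_in (X : nat -> Prop) (R : nat -> nat -> Prop) : Prop :=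
  partial_computable_in (jump X) R.

Definition relatively_delta02_categorical {L : language} (A : structure L) : Prop :=
  forall B : structure L, isomorphic A B ->
    exists f : nat -> nat,
      isomorphism A B f /\
      delta02_in (join (atomic_diagram A) (atomic_diagram B))
        (fun a b => universe A a /\ b = f a).

(* Main.v *)
From Stdlib Require Import Arith List Lia Cantor ClassicalEpsilon.
Require Import Defs.
Import ListNotations.

(** Call a finite list [p] of pairs in A x B type preserving if its left and right
    columns satisfy the same atomic formulas. Equivalently, the substructure
    of A x B generated by [p] under the function symbols is the graph of an
    injective map which respects the relations, that is, of an isomorphism
    between finitely generated substructures of A and B. If A and B are
    isomorphic and A is ultrahomogeneous, such a [p] extends to an
    isomorphism from A to B ([type_preserving_extends]): transport the map to
    A along some isomorphism, extend it to an automorphism and transport back.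
    Hence every element of A or B can be given a partner so that the longer
    list is again type preserving, and a back-and-forth construction which
    always takes the least partner that keeps the list type preserving yields an
    isomorphism ([back_and_forth], [chain_isomorphism]).

    Its complexity rests on one observation. A failure of type preservation has
    a finite witness: a derivation of some generated pairs by applications of
    function symbols, together with an equation or a relation on which their
    two columns differ. The two atomic diagrams decide whether a given object is
    such a witness, so type preservation is co-enumerable in their join and
    decidable in the jump of the join ([type_preserving_decidable_jump]); with
    this oracle every step of the construction is computable.

    The programs are obtained from closure properties of the functions
    computable in an oracle. For these the types involved are identified with
    [nat] by bijections, so that a search through a type is a search through
    [nat]. *)

(** * Coded types *)

Class coded (T : Type) : Type := {
  num : T -> nat;
  unnum : nat -> T;
  unnum_num : forall t, unnum (num t) = t;
  num_unnum : forall n, num (unnum n) = n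
}.

Lemma num_inj {T} `{coded T} (t u : T) : num t = num u -> t = u.
Proof. intros E. rewrite <- (unnum_num t), E. apply unnum_num. Qed.

Lemma fst_pair_num x y : fst (Cantor.of_nat (pair_num x y)) = x.
Proof. unfold pair_num. now rewrite Cantor.cancel_of_to. Qed.

Lemma snd_pair_num x y : snd (Cantor.of_nat (pair_num x y)) = y.
Proof. unfold pair_num. now rewrite Cantor.cancel_of_to. Qed.

Lemma pair_num_surj n :
  pair_num (fst (Cantor.of_nat n)) (snd (Cantor.of_nat n)) = n.
Proof. unfold pair_num. rewrite <- surjective_pairing. apply Cantor.cancel_to_of. Qed.

#[export] Instance coded_nat : coded nat.
Proof. now exists (fun n => n) (fun n => n). Defined.

#[export] Instance coded_prod {T U} `{coded T} `{coded U} : coded (T * U).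
Proof.
  exists (fun p => pair_num (num (fst p)) (num (snd p)))
    (fun n => (unnum (fst (Cantor.of_nat n)), unnum (snd (Cantor.of_nat n)))).
  - intros [t u]. cbn [fst snd].
    now rewrite fst_pair_num, snd_pair_num, !unnum_num.
  - intros n. cbn [fst snd]. rewrite !num_unnum. apply pair_num_surj.
Defined.

(** The code of the tail is smaller than that of the list without being a
    structural part of it, so the recursion is on a bound for the code. *)
Fixpoint list_unnum {T} `{coded T} (bound n : nat) : list T :=
  match bound, n with
  | S b, S m => unnum (fst (Cantor.of_nat m)) :: list_unnum b (snd (Cantor.of_nat m))
  | _, _ => []
  end.

Lemma snd_of_nat_le n : snd (Cantor.of_nat n) <= n.
Proof.
  rewrite <- (pair_num_surj n) at 2. unfold pair_num.
  pose proof (Cantor.to_nat_non_decreasing (fst (Cantor.of_nat n)) (snd (Cantor.of_nat n))).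
  lia.
Qed.

Lemma list_num_unnum {T} `{coded T} b n :
  n <= b -> list_num (map num (list_unnum b n : list T)) = n.
Proof.
  revert n. induction b as [|b IH]; intros [|m] Hle; simpl; try lia.
  rewrite num_unnum, IH.
  - now rewrite pair_num_surj.
  - pose proof (snd_of_nat_le m). lia.
Qed.

#[export] Instance coded_list {T} `{coded T} : coded (list T).
Proof.
  exists (fun l => list_num (map num l)) (fun n => list_unnum n n).
  - intros l. apply (list_num_map_inj _ num).
    + intros x _ y. apply num_inj.
    + now apply list_num_unnum.
  - intros n. now apply list_num_unnum.
Defined.

Lemma length_le_num {T} `{coded T} (l : list T) : length l <= num l.
Proof.
  induction l as [|x l IH]; simpl; [lia|]. simpl in IH. unfold pair_num.
  pose proof (Cantor.to_nat_non_decreasing (num x) (list_num (map num l))). lia.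
Qed.

(** * Functions computable in an oracle *)

Definition computable_in {T U} `{coded T} `{coded U}
    (X : nat -> Prop) (f : T -> U) : Prop :=
  exists c, forall t y, eval X c (num t) y <-> y = num (f t).

Lemma computable_ext {X : nat -> Prop} {T U} `{coded T} `{coded U} (f g : T -> U) :
  (forall t, f t = g t) -> computable_in X f -> computable_in X g.
Proof.
  intros E [c Hc]. exists c. intros t y. rewrite <- E. apply Hc.
Qed.

(** Bijectivity of the pairing turns the program that splits and pairs again into
    the identity. *)
Lemma computable_id {X : nat -> Prop} {T} `{coded T} : computable_in X (fun t : T => t).
Proof.
  exists (Pair Fst Snd). intros t y. simpl. split.
  - intros (a & b & -> & -> & ->). apply pair_num_surj.
  - intros ->. do 2 eexists. repeat split. symmetry. apply pair_num_surj.
Qed.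

Lemma computable_const {X : nat -> Prop} {T U} `{coded T} `{coded U} (u : U) :
  computable_in X (fun _ : T => u).
Proof. exists (Const (num u)). reflexivity. Qed.

Lemma computable_comp {X : nat -> Prop} {T U V} `{coded T} `{coded U} `{coded V}
    (g : U -> V) (f : T -> U) :
  computable_in X g -> computable_in X f -> computable_in X (fun t => g (f t)).
Proof.
  intros [d Hd] [c Hc]. exists (Comp d c). intros t y. simpl. split.
  - intros (a & Ha & Hy). apply Hc in Ha. subst a. now apply Hd.
  - intros ->. exists (num (f t)). split; [now apply Hc | now apply Hd].
Qed.

Lemma computable_pair {X : nat -> Prop} {T U V} `{coded T} `{coded U} `{coded V}
    (f : T -> U) (g : T -> V) :
  computable_in X f -> computable_in X g -> computable_in X (fun t => (f t, g t)).
Proof.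
  intros [c Hc] [d Hd]. exists (Pair c d). intros t y. simpl. split.
  - intros (a & b & Ha & Hb & ->). apply Hc in Ha. apply Hd in Hb. now subst.
  - intros ->. exists (num (f t)), (num (g t)).
    repeat split; [now apply Hc | now apply Hd].
Qed.

Lemma computable_fst {X : nat -> Prop} {T U V} `{coded T} `{coded U} `{coded V} (f : T -> U * V) :
  computable_in X f -> computable_in X (fun t => fst (f t)).
Proof.
  apply (computable_comp fst). exists Fst. intros [u v] y. simpl.
  now rewrite fst_pair_num.
Qed.

Lemma computable_snd {X : nat -> Prop} {T U V} `{coded T} `{coded U} `{coded V} (f : T -> U * V) :
  computable_in X f -> computable_in X (fun t => snd (f t)).
Proof.
  apply (computable_comp snd). exists Snd. intros [u v] y. simpl.
  now rewrite snd_pair_num.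
Qed.

Lemma computable_S {X : nat -> Prop} {T} `{coded T} (f : T -> nat) :
  computable_in X f -> computable_in X (fun t => S (f t)).
Proof. apply (computable_comp S). exists Succ. reflexivity. Qed.

Lemma computable_num {X : nat -> Prop} {T U} `{coded T} `{coded U} (f : T -> U) :
  computable_in X f -> computable_in X (fun t => num (f t)).
Proof. intros [c Hc]. now exists c. Qed.

Lemma computable_unnum {X : nat -> Prop} {T U} `{coded T} `{coded U} (f : T -> nat) :
  computable_in X f -> computable_in X (fun t => unnum (f t) : U).
Proof.
  intros [c Hc]. exists c. intros t y. rewrite num_unnum. apply Hc.
Qed.

(** Unification leaves projections and codes eta-reduced, hence the cases for
    them without an abstraction. *)
Ltac computable_step :=
  lazymatch goal with
  | |- computable_in _ (fun x => x) => apply computable_id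
  | |- computable_in _ fst => apply (computable_fst (fun x => x))
  | |- computable_in _ snd => apply (computable_snd (fun x => x))
  | |- computable_in _ num => apply (computable_num (fun x => x))
  | |- computable_in _ (fun x => (@?f x, @?g x)) => apply (computable_pair f g)
  | |- computable_in _ (fun x => fst (@?f x)) => apply (computable_fst f)
  | |- computable_in _ (fun x => snd (@?f x)) => apply (computable_snd f)
  | |- computable_in _ (fun x => S (@?f x)) => apply (computable_S f)
  | |- computable_in _ (fun x => num (@?f x)) => apply (computable_num f)
  | |- computable_in _ (fun x => unnum (@?f x)) => apply (computable_unnum f)
  | |- computable_in _ (fun _ => ?u) => apply (computable_const u)
  end.
Ltac prove_computable := repeat first [assumption | computable_step].

Lemma computable_pair_num {X : nat -> Prop} {T} `{coded T} (f g : T -> nat) :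
  computable_in X f -> computable_in X g ->
  computable_in X (fun t => pair_num (f t) (g t)).
Proof.
  intros Hf Hg. exact (computable_num _ (computable_pair _ _ Hf Hg)).
Qed.

Lemma computable_nat_rec {X : nat -> Prop} {T U} `{coded T} `{coded U}
    (n : T -> nat) (a : T -> U) (h : T * (nat * U) -> U) :
  computable_in X n -> computable_in X a -> computable_in X h ->
  computable_in X
    (fun t => nat_rect (fun _ => U) (a t) (fun k u => h (t, (k, u))) (n t)).
Proof.
  intros Hn [c Hc] [d Hd].
  enough (Hr : computable_in X (fun p : T * nat =>
    nat_rect (fun _ => U) (a (fst p)) (fun k u => h (fst p, (k, u))) (snd p))).
  { exact (computable_comp _ _ Hr (computable_pair _ _ computable_id Hn)). }
  exists (Prec c d). intros [t m]. cbn [eval num coded_prod coded_nat fst snd].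
  rewrite fst_pair_num, snd_pair_num.
  induction m as [|m IH]; intros y; simpl.
  - apply Hc.
  - rewrite <- (Hd (t, (m, _))). simpl. split.
    + intros (z & Hz & Hy). apply IH in Hz. now subst z.
    + intros Hy. eexists. split; [now apply IH | exact Hy].
Qed.

(** A recursion whose step ignores the value computed so far. *)
Lemma computable_nat_case {X : nat -> Prop} {T U} `{coded T} `{coded U}
    (n : T -> nat) (a : T -> U) (h : T * nat -> U) :
  computable_in X n -> computable_in X a -> computable_in X h ->
  computable_in X
    (fun t => match n t with 0 => a t | S m => h (t, m) end).
Proof.
  intros Hn Ha Hh.
  apply (computable_ext (fun t =>
    nat_rect (fun _ => U) (a t) (fun k u => h (fst (t, (k, u)), fst (snd (t, (k, u))))) (n t))).
  - intros t. now destruct (n t).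
  - apply (computable_nat_rec n a
      (fun z => h (fst z, fst (snd z)))); auto.
    apply (computable_comp h); auto.
    prove_computable.
Qed.

Lemma computable_list_case {X : nat -> Prop} {T U V} `{coded T} `{coded U} `{coded V}
    (l : T -> list V) (a : T -> U) (h : T * (V * list V) -> U) :
  computable_in X l -> computable_in X a -> computable_in X h ->
  computable_in X
    (fun t => match l t with [] => a t | x :: r => h (t, (x, r)) end).
Proof.
  intros Hl Ha Hh.
  apply (computable_ext (fun t =>
    match num (l t) with
    | 0 => a t
    | S m => h (fst (t, m), unnum (snd (t, m)))
    end)).
  - intros t. destruct (l t) as [|x r]; [reflexivity|].
    change (num (x :: r)) with (S (num (x, r))).
    cbn [fst snd]. now rewrite unnum_num.
  - apply (computable_nat_case (fun t => num (l t)) a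
      (fun z => h (fst z, unnum (snd z)))); prove_computable.
    apply (computable_comp h); auto.
    apply computable_pair; [apply computable_fst | apply computable_unnum, computable_snd];
      apply computable_id.
Qed.

Lemma computable_cons {X : nat -> Prop} {T U} `{coded T} `{coded U} (x : T -> U) (l : T -> list U) :
  computable_in X x -> computable_in X l -> computable_in X (fun t => x t :: l t).
Proof.
  intros Hx Hl.
  destruct (computable_S _ (computable_num _ (computable_pair _ _ Hx Hl))) as [c Hc].
  now exists c.
Qed.

(** The pair of the remaining list and the accumulator is iterated; the code of
    the list serves as the number of rounds, since extra rounds on the empty
    list do nothing. *)
Lemma computable_fold_left {X : nat -> Prop} {T U V} `{coded T} `{coded U} `{coded V}
    (h : T -> U -> V -> U) (l : T -> list V) (a : T -> U) :
  computable_in X (fun z : T * (U * V) => h (fst z) (fst (snd z)) (snd (snd z))) ->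
  computable_in X l -> computable_in X a ->
  computable_in X (fun t => fold_left (h t) (l t) (a t)).
Proof.
  intros Hh Hl Ha.
  pose (next := fun (t : T) (s : list V * U) =>
    match fst s with [] => s | x :: r => (r, h t (snd s) x) end).
  assert (Hiter : forall t n (r : list V) (u : U), length r <= n ->
    snd (nat_rect (fun _ => (list V * U)%type) (r, u) (fun _ s => next t s) n)
      = fold_left (h t) r u).
  { intros t n. induction n as [|n IH]; intros r u Hle.
    - now destruct r; [|simpl in Hle; lia].
    - assert (Hs : forall s, nat_rect (fun _ => (list V * U)%type) s
          (fun _ s => next t s) (S n) = nat_rect (fun _ => (list V * U)%type) (next t s)
          (fun _ s => next t s) n).
      { intros s. clear. induction n as [|n IH]; [reflexivity|].
        simpl in *. now rewrite IH. }
      rewrite Hs. destruct r as [|x r]; unfold next at 2; simpl.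
      + apply IH. simpl. lia.
      + apply IH. simpl in Hle. lia. }
  apply (computable_ext (fun t => snd (nat_rect (fun _ => (list V * U)%type)
     (l t, a t) (fun k s => next (fst (t, (k, s))) (snd (snd (t, (k, s))))) (num (l t))))).
  { intros t. exact (Hiter t _ _ _ (length_le_num (l t))). }
  apply computable_snd.
  apply (computable_nat_rec _ _ (fun z => next (fst z) (snd (snd z))));
    prove_computable.
  unfold next.
  apply (computable_list_case (fun z : T * (nat * (list V * U)) => fst (snd (snd z)))
    (fun z => snd (snd z))
    (fun w => (snd (snd w), h (fst (fst w)) (snd (snd (snd (fst w)))) (fst (snd w))))).
  - prove_computable.
  - prove_computable.
  - apply computable_pair.
    + prove_computable.
    + apply (computable_comp (fun z => h (fst z) (fst (snd z)) (snd (snd z)))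
        (fun w : T * (nat * (list V * U)) * (V * list V) =>
           (fst (fst w), (snd (snd (snd (fst w))), fst (snd w))))); auto.
      prove_computable.
Qed.

(** * Decidable relations, search and the jump *)

Definition decidable_in {T} `{coded T} (X : nat -> Prop) (P : T -> Prop) : Prop :=
  computable_in X (fun t => if excluded_middle_informative (P t) then 0 else 1).

Ltac by_cases :=
  repeat match goal with
  | |- context [excluded_middle_informative ?P] =>
      destruct (excluded_middle_informative P)
  end.

Lemma decidable_ext {X : nat -> Prop} {T} `{coded T} (P Q : T -> Prop) :
  (forall t, P t <-> Q t) -> decidable_in X P -> decidable_in X Q.
Proof.
  intros E. apply computable_ext. intros t. specialize (E t). by_cases; tauto.
Qed.

Lemma computable_if {X : nat -> Prop} {T U} `{coded T} `{coded U}
    (P : T -> Prop) (f g : T -> U) :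
  decidable_in X P -> computable_in X f -> computable_in X g ->
  computable_in X (fun t => if excluded_middle_informative (P t) then f t else g t).
Proof.
  intros HP Hf Hg.
  apply (computable_ext (fun t =>
    match (if excluded_middle_informative (P t) then 0 else 1) with
    | 0 => f t
    | S m => g (fst (t, m))
    end)).
  - intros t. now by_cases.
  - apply (computable_nat_case _ f (fun z => g (fst z)) HP Hf).
    apply (computable_comp g); prove_computable.
Qed.

Lemma decidable_comp {X : nat -> Prop} {T U} `{coded T} `{coded U}
    (P : U -> Prop) (f : T -> U) :
  decidable_in X P -> computable_in X f -> decidable_in X (fun t => P (f t)).
Proof. exact (computable_comp _ f). Qed.

Lemma decidable_not {X : nat -> Prop} {T} `{coded T} (P : T -> Prop) :
  decidable_in X P -> decidable_in X (fun t => ~ P t).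
Proof.
  intros HP.
  apply (computable_ext (fun t => if excluded_middle_informative (P t) then 1 else 0)).
  - intros t. by_cases; tauto.
  - apply computable_if; prove_computable.
Qed.

Lemma decidable_and {X : nat -> Prop} {T} `{coded T} (P Q : T -> Prop) :
  decidable_in X P -> decidable_in X Q -> decidable_in X (fun t => P t /\ Q t).
Proof.
  intros HP HQ.
  apply (computable_ext (fun t => if excluded_middle_informative (P t) then
    (if excluded_middle_informative (Q t) then 0 else 1) else 1)).
  - intros t. by_cases; tauto.
  - apply computable_if; prove_computable.
Qed.

Lemma decidable_or {X : nat -> Prop} {T} `{coded T} (P Q : T -> Prop) :
  decidable_in X P -> decidable_in X Q -> decidable_in X (fun t => P t \/ Q t).
Proof.
  intros HP HQ.
  apply (computable_ext (fun t => if excluded_middle_informative (P t) then 0 else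
    (if excluded_middle_informative (Q t) then 0 else 1))).
  - intros t. by_cases; tauto.
  - apply computable_if; prove_computable.
Qed.

Lemma computable_pred {X : nat -> Prop} {T} `{coded T} (f : T -> nat) :
  computable_in X f -> computable_in X (fun t => pred (f t)).
Proof.
  intros Hf.
  apply (computable_ext (fun t => match f t with 0 => 0 | S m => snd (t, m) end)).
  - intros t. now destruct (f t).
  - apply (computable_nat_case f (fun _ => 0) snd); prove_computable.
Qed.

Lemma computable_sub {X : nat -> Prop} {T} `{coded T} (f g : T -> nat) :
  computable_in X f -> computable_in X g -> computable_in X (fun t => f t - g t).
Proof.
  intros Hf Hg.
  apply (computable_ext (fun t =>
    nat_rect (fun _ => nat) (f t) (fun k u => pred (snd (snd (t, (k, u))))) (g t))).
  - intros t. induction (g t) as [|k IH]; cbn [nat_rect snd] in *; lia.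
  - apply (computable_nat_rec g f (fun z => pred (snd (snd z)))); auto.
    apply computable_pred. prove_computable.
Qed.

Lemma decidable_eq {X : nat -> Prop} {T U} `{coded T} `{coded U} (f g : T -> U) :
  computable_in X f -> computable_in X g -> decidable_in X (fun t => f t = g t).
Proof.
  intros Hf Hg.
  assert (Hle : forall f g : T -> nat, computable_in X f -> computable_in X g ->
    decidable_in X (fun t => f t <= g t)).
  { clear. intros f g Hf Hg.
    apply (computable_ext (fun t => match f t - g t with 0 => 0 | S m => 1 end)).
    - intros t. by_cases; destruct (f t - g t) eqn:E; lia.
    - apply (computable_nat_case (fun t => f t - g t) (fun _ => 0) (fun _ => 1));
        prove_computable.
      now apply computable_sub. }
  apply (decidable_ext (fun t => num (f t) <= num (g t) /\ num (g t) <= num (f t))).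
  - intros t. split.
    + intros [? ?]. apply num_inj. lia.
    + intros ->. lia.
  - apply decidable_and; apply Hle; prove_computable.
Qed.

Lemma decidable_Forall {X : nat -> Prop} {T V} `{coded T} `{coded V}
    (P : T -> V -> Prop) (l : T -> list V) :
  decidable_in X (fun z : T * V => P (fst z) (snd z)) -> computable_in X l ->
  decidable_in X (fun t => Forall (P t) (l t)).
Proof.
  intros HP Hl.
  apply (computable_ext (fun t => fold_left (fun u x =>
    if excluded_middle_informative (P t x) then u else 1) (l t) 0)).
  - intros t.
    assert (E1 : fold_left (fun u x =>
      if excluded_middle_informative (P t x) then u else 1) (l t) 1 = 1).
    { induction (l t) as [|x r IH]; simpl; [easy|]. now by_cases. }
    induction (l t) as [|x r IH]; simpl in *.
    + by_cases; [easy|]. now destruct n.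
    + destruct (excluded_middle_informative (P t x)) as [Hx|Hx].
      * rewrite IH by assumption. by_cases; trivial.
        -- now destruct n; constructor.
        -- now inversion f.
      * by_cases.
        -- now inversion f.
        -- exact E1.
  - apply (computable_fold_left (fun t u x =>
      if excluded_middle_informative (P t x) then u else 1)); prove_computable.
    apply (computable_if (fun z : T * (nat * V) => P (fst z) (snd (snd z))));
      prove_computable.
    apply (decidable_comp _ (fun z : T * (nat * V) => (fst z, snd (snd z))) HP).
    prove_computable.
Qed.

Lemma decidable_In {X : nat -> Prop} {T V} `{coded T} `{coded V}
    (x : T -> V) (l : T -> list V) :
  computable_in X x -> computable_in X l -> decidable_in X (fun t => In (x t) (l t)).
Proof.
  intros Hx Hl.
  apply (decidable_ext (fun t => ~ Forall (fun y => x t <> y) (l t))).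
  - intros t. rewrite Forall_forall. split.
    + intros Hn. apply NNPP. intros Hi. apply Hn. now intros y Hy <-.
    + intros Hi Hn. exact (Hn _ Hi eq_refl).
  - apply decidable_not, decidable_Forall; auto.
    apply decidable_not, decidable_eq; prove_computable.
    apply (computable_comp x); prove_computable.
Qed.

Lemma computable_map {X : nat -> Prop} {T U V} `{coded T} `{coded U} `{coded V}
    (f : U -> V) (l : T -> list U) :
  computable_in X f -> computable_in X l -> computable_in X (fun t => map f (l t)).
Proof.
  intros Hf Hl.
  assert (Hcons : forall (W W' : Type) (cW : coded W) (cW' : coded W') (g : W -> W')
    (m : T -> list W), computable_in X g -> computable_in X m ->
    computable_in X (fun t => fold_left (fun acc x => g x :: acc) (m t) [])).
  { intros W W' cW cW' g m Hg Hm.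
    apply (computable_fold_left (fun _ acc x => g x :: acc)); prove_computable.
    apply computable_cons; prove_computable.
    apply (computable_comp g); prove_computable. }
  apply (computable_ext (fun t => fold_left (fun acc x => f x :: acc)
    (fold_left (fun acc x => x :: acc) (l t) []) [])).
  - intros t. rewrite <- (fold_left_rev_right (fun x acc => x :: acc) (l t)).
    assert (E : forall m : list U, fold_right (fun x acc => x :: acc) [] m = m).
    { induction m as [|x m IH]; simpl; congruence. }
    rewrite E, <- (fold_left_rev_right (fun x acc => f x :: acc)), rev_involutive.
    induction (l t) as [|x m IH]; simpl; congruence.
  - apply (Hcons _ _ _ _ f); auto. apply (Hcons _ _ _ _ (fun x => x)); auto. prove_computable.
Qed.

(** [Query] answers 1 on members, whereas [decidable_in] asks for 0. *)
Lemma decidable_oracle {T} `{coded T} (X : nat -> Prop) (f : T -> nat) :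
  computable_in X f -> decidable_in X (fun t => X (f t)).
Proof.
  intros Hf. apply (decidable_comp X f); auto.
  apply (computable_ext (fun n => 1 - (if excluded_middle_informative (X n) then 1 else 0))).
  - intros n. now by_cases.
  - apply computable_sub; prove_computable.
    exists Query. intros n y. simpl. by_cases; tauto.
Qed.

Lemma least_witness (P : nat -> Prop) :
  (exists n, P n) -> exists n, P n /\ forall j, j < n -> ~ P j.
Proof.
  intros [n Hn]. induction n as [n IH] using lt_wf_ind.
  destruct (classic (exists j, j < n /\ P j)) as [(j & Hlt & Hj)|Hno].
  - exact (IH j Hlt Hj).
  - exists n. split; auto. intros j Hlt Hj. apply Hno. now exists j.
Qed.

(** Stated for the graph of the program, so that it also serves where the search
    does not terminate. *)
Lemma eval_Mu_decidable {X : nat -> Prop} {T} `{coded T} (P : T -> nat -> Prop) :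
  decidable_in X (fun z : T * nat => P (fst z) (snd z)) ->
  exists c, forall t y, eval X c (num t) y <-> P t y /\ forall j, j < y -> ~ P t j.
Proof.
  intros [c Hc]. exists (Mu c). intros t y. cbn [eval].
  assert (E : forall j z, eval X c (pair_num (num t) j) z <->
    z = if excluded_middle_informative (P t j) then 0 else 1).
  { intros j z. exact (Hc (t, j) z). }
  rewrite E. split.
  - intros [H0 Hj]. split; [revert H0; by_cases; easy|].
    intros j Hlt HP. destruct (Hj j Hlt) as [z Hz]. apply E in Hz.
    revert Hz. by_cases; easy.
  - intros [H0 Hj]. split; [by_cases; easy|].
    intros j Hlt. exists 0. apply E. specialize (Hj j Hlt). by_cases; easy.
Qed.

Lemma computable_search {X : nat -> Prop} {T} `{coded T} (P : T -> nat -> Prop) :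
  decidable_in X (fun z : T * nat => P (fst z) (snd z)) ->
  (forall t, exists n, P t n) ->
  exists f : T -> nat, computable_in X f /\ forall t, P t (f t).
Proof.
  intros HP Hex.
  pose (g := fun t => constructive_indefinite_description _ (least_witness _ (Hex t))).
  exists (fun t => proj1_sig (g t)). split.
  - destruct (eval_Mu_decidable P HP) as [c Hc]. exists c. intros t y.
    rewrite Hc. destruct (g t) as [n [Hn Hmin]]. simpl. split.
    + intros [Hy Hmin']. apply Nat.le_antisymm; apply Nat.nlt_ge; intros Hlt.
      * now apply (Hmin' n).
      * now apply (Hmin y).
    + intros ->. auto.
  - intros t. now destruct (g t) as [n [Hn Hmin]].
Qed.

(** An instance of the search for a witness becomes a question to the jump by
    fixing its input: the program that first replaces any input, in particular
    its own index, by the code of [t] halts exactly when a witness exists, and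
    its index is computed from [t] by pairing alone. *)
Lemma decidable_exists_jump {X : nat -> Prop} {T W} `{coded T} `{coded W}
    (P : T -> W -> Prop) :
  decidable_in X (fun z : T * W => P (fst z) (snd z)) ->
  decidable_in (jump X) (fun t => exists w, P t w).
Proof.
  intros HP.
  destruct (eval_Mu_decidable (X := X) (fun t n => P t (unnum n))) as [c Hc].
  { apply (decidable_comp _ (fun z : T * nat => (fst z, unnum (snd z))) HP).
    prove_computable. }
  apply (decidable_ext (fun t => jump X (code_num (Comp c (Const (num t)))))).
  - intros t. unfold jump. split.
    + intros (d & y & Hd & Hy). apply code_num_inj in Hd. subst d. simpl in Hy.
      destruct Hy as (a & -> & Hy). apply Hc in Hy. now exists (unnum y).
    + intros [w Hw].
      destruct (least_witness (fun n => P t (unnum n))) as [y Hy].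
      { exists (num w). now rewrite unnum_num. }
      exists (Comp c (Const (num t))), y. split; auto.
      exists (num t). split; [reflexivity|]. now apply Hc.
  - apply decidable_oracle. simpl.
    repeat apply computable_pair_num; prove_computable.
Qed.

Lemma decidable_jump {X : nat -> Prop} {T} `{coded T} (P : T -> Prop) :
  decidable_in X P -> decidable_in (jump X) P.
Proof.
  intros HP.
  apply (decidable_ext (fun t => exists _ : nat, P t)).
  - intros t. split; [now intros [_ Ht] | now exists 0].
  - apply decidable_exists_jump.
    apply (decidable_comp P (fun z : T * nat => fst z) HP). prove_computable.
Qed.

(** * Finite partial maps with equal atomic types *)

(** The substructure of A x B generated by [p], which consists of the pairs of
    values of a common term at the two columns of [p]. Using it in place of
    terms, one never has to handle codes of nested terms. *)
Inductive generated {L : language} (A B : structure L) (p : list (nat * nat)) :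
    nat * nat -> Prop :=
| generated_in x : In x p -> generated A B p x
| generated_app s xs :
    fun_arity L s = Some (length xs) -> (forall x, In x xs -> generated A B p x) ->
    generated A B p (fun_interp A s (map fst xs), fun_interp B s (map snd xs)).

Record type_preserving {L : language} (A B : structure L) (p : list (nat * nat)) :
    Prop := {
  tp_universe : forall x, In x p -> universe A (fst x) /\ universe B (snd x);
  tp_eq : forall x y, generated A B p x -> generated A B p y ->
    (fst x = fst y <-> snd x = snd y);
  tp_rel : forall s xs,
    rel_arity L s = Some (length xs) -> (forall x, In x xs -> generated A B p x) ->
    (rel_interp A s (map fst xs) <-> rel_interp B s (map snd xs))
}.

(** A choice of witnesses along a list; it turns a list of elements of a
    projection of the generated substructure into a list of generated pairs. *)
Lemma map_common_values {U V W} (f : U -> W) (g : V -> W) (G : V -> Prop) (us : list U) :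
  (forall u, In u us -> exists v, G v /\ f u = g v) ->
  exists vs, (forall v, In v vs -> G v) /\ map f us = map g vs.
Proof.
  induction us as [|u us IH]; intros Hus.
  - now exists [].
  - destruct IH as (vs & Hvs & E); [intros; apply Hus; now right|].
    destruct (Hus u) as (v & Hv & Ev); [now left|].
    exists (v :: vs). split.
    + intros w [<-|Hw]; auto.
    + simpl. congruence.
Qed.

Lemma map_eq_length {U V W} (f : U -> W) (g : V -> W) us vs :
  map f us = map g vs -> length us = length vs.
Proof. intros E. now rewrite <- (length_map f us), E, length_map. Qed.

Lemma Forall_map_intro {U V} (f : U -> V) (P : V -> Prop) us :
  (forall u, In u us -> P (f u)) -> Forall P (map f us).
Proof. intros Hu. apply Forall_map, Forall_forall, Hu. Qed.

Lemma isomorphism_comp {L : language} (A B C : structure L) g h :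
  isomorphism A B g -> isomorphism B C h -> isomorphism A C (fun a => h (g a)).
Proof.
  intros Hg Hh.
  assert (Hmaps : forall args, Forall (universe A) args -> Forall (universe B) (map g args)).
  { intros args Hargs. apply Forall_map. revert Hargs. apply Forall_impl, (iso_maps _ _ _ Hg). }
  constructor.
  - intros a Ha. now apply (iso_maps _ _ _ Hh), (iso_maps _ _ _ Hg).
  - intros a a' Ha Ha' E. apply (iso_inj _ _ _ Hg); auto.
    apply (iso_inj _ _ _ Hh); auto; now apply (iso_maps _ _ _ Hg).
  - intros c Hc. destruct (iso_surj _ _ _ Hh c Hc) as (b & Hb & <-).
    destruct (iso_surj _ _ _ Hg b Hb) as (a & Ha & <-). now exists a.
  - intros s args Hs Hargs.
    rewrite (iso_fun _ _ _ Hg), (iso_fun _ _ _ Hh), map_map; auto.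
    now rewrite length_map.
  - intros s args Hs Hargs.
    rewrite (iso_rel _ _ _ Hg), (iso_rel _ _ _ Hh), map_map; [easy| | |auto|auto].
    + now rewrite length_map.
    + auto.
Qed.

Section Maps.
Context {L : language} (A B : structure L).

Lemma generated_universe p x :
  (forall x, In x p -> universe A (fst x) /\ universe B (snd x)) ->
  generated A B p x -> universe A (fst x) /\ universe B (snd x).
Proof.
  intros Hp. induction 1 as [x Hx|s xs Hs _ IH]; auto. split.
  - apply fun_interp_closed; [now rewrite length_map|].
    apply Forall_map_intro. now apply IH.
  - apply fun_interp_closed; [now rewrite length_map|].
    apply Forall_map_intro. now apply IH.
Qed.

Lemma generated_graph p g x :
  isomorphism A B g ->
  (forall x, In x p -> universe A (fst x) /\ snd x = g (fst x)) ->
  generated A B p x -> universe A (fst x) /\ snd x = g (fst x).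
Proof.
  intros Hg Hp. induction 1 as [x Hx|s xs Hs _ IH]; auto. cbn [fst snd].
  assert (HA : Forall (universe A) (map fst xs)).
  { apply Forall_map_intro. now apply IH. }
  split.
  - apply fun_interp_closed; [now rewrite length_map | exact HA].
  - rewrite (iso_fun _ _ _ Hg), map_map by (auto; now rewrite length_map).
    f_equal. apply map_ext_in. now apply IH.
Qed.

Lemma isomorphism_type_preserving p g :
  isomorphism A B g ->
  (forall x, In x p -> universe A (fst x) /\ snd x = g (fst x)) ->
  type_preserving A B p.
Proof.
  intros Hg Hp.
  pose proof (fun x => generated_graph p g x Hg Hp) as Hgr. constructor.
  - intros x Hx. destruct (Hp x Hx) as [Ha Hb]. split; auto.
    rewrite Hb. now apply (iso_maps _ _ _ Hg).
  - intros x y Hx Hy. destruct (Hgr x Hx) as [Hxa ->], (Hgr y Hy) as [Hya ->]. split.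
    + congruence.
    + now apply (iso_inj _ _ _ Hg).
  - intros s xs Hs Hxs.
    rewrite (iso_rel _ _ _ Hg), map_map.
    + replace (map snd xs) with (map (fun x => g (fst x)) xs); [reflexivity|].
      apply map_ext_in. intros x Hx. symmetry. now apply Hgr, Hxs.
    + now rewrite length_map.
    + apply Forall_map_intro. intros x Hx. now apply Hgr, Hxs.
Qed.

Definition induced (U : nat -> Prop)
    (closed : forall s args, fun_arity L s = Some (length args) -> Forall U args ->
      U (fun_interp A s args)) : structure L :=
  {| universe := U; rel_interp := rel_interp A; fun_interp := fun_interp A;
     fun_interp_closed := closed |}.

Lemma induced_substructure U closed :
  (forall a, U a -> universe A a) -> substructure (induced U closed) A.
Proof. intros HU. now constructor. Qed.

(** Choose an isomorphism [h] from A to B. Pulled back along [h], the generated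
    pairs form the graph of an isomorphism [f] between substructures of A
    generated by the two columns of [p]; if the automorphism [g] extends [f],
    then [h] after [g] extends [p]. *)
Lemma type_preserving_extends p :
  ultrahomogeneous A -> isomorphic A B -> type_preserving A B p ->
  exists g, isomorphism A B g /\ forall x, In x p -> snd x = g (fst x).
Proof.
  intros hom [h Hh] Hp.
  pose (G := generated A B p).
  assert (HG : forall x, G x -> universe A (fst x) /\ universe B (snd x)).
  { intros x. apply generated_universe, Hp. }
  (* [f] sends the left entry of a generated pair to the preimage under [h] of its
     right entry. *)
  pose (f := fun a => epsilon (inhabits 0)
    (fun a' => universe A a' /\ exists x, G x /\ fst x = a /\ h a' = snd x)).
  assert (Hf : forall x, G x -> universe A (f (fst x)) /\ h (f (fst x)) = snd x).
  { intros x Hx.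
    destruct (epsilon_spec (inhabits 0)
      (fun a' => universe A a' /\ exists y, G y /\ fst y = fst x /\ h a' = snd y))
      as (HA & y & Hy & E & Ey).
    - destruct (iso_surj _ _ _ Hh (snd x)) as (a' & Ha' & E); [now apply HG|].
      exists a'. split; [exact Ha'|]. now exists x.
    - split; [exact HA|]. unfold f. rewrite Ey. now apply (tp_eq _ _ _ Hp). }
  pose (U := fun a => exists x, G x /\ a = fst x).
  pose (V := fun a => universe A a /\ exists x, G x /\ h a = snd x).
  assert (HUA : forall a, U a -> universe A a).
  { intros a (x & Hx & ->). now apply HG. }
  assert (HVA : forall a, V a -> universe A a) by now intros a [Ha _].
  assert (liftU : forall us, Forall U us ->
    exists xs, (forall x, In x xs -> G x) /\ us = map fst xs /\ length us = length xs).
  { intros us Hus. rewrite Forall_forall in Hus.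
    destruct (map_common_values (fun a => a) fst G us Hus) as (xs & Hxs & E). rewrite map_id in E.
    exists xs. repeat split; auto. now rewrite E, length_map. }
  assert (liftV : forall us, Forall V us ->
    exists xs, (forall x, In x xs -> G x) /\ map h us = map snd xs /\ length us = length xs).
  { intros us Hus. rewrite Forall_forall in Hus.
    destruct (map_common_values h snd G us) as (xs & Hxs & E); [intros u Hu; now apply Hus|].
    exists xs. repeat split; auto. now apply map_eq_length in E. }
  assert (cU : forall s args, fun_arity L s = Some (length args) -> Forall U args ->
    U (fun_interp A s args)).
  { intros s args Hs Hargs. destruct (liftU _ Hargs) as (xs & Hxs & -> & El).
    rewrite El in Hs.
    eexists. split; [exact (generated_app _ _ _ _ _ Hs Hxs) | reflexivity]. }
  assert (cV : forall s args, fun_arity L s = Some (length args) -> Forall V args ->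
    V (fun_interp A s args)).
  { intros s args Hs Hargs.
    assert (HA : Forall (universe A) args) by exact (Forall_impl _ HVA Hargs).
    split; [now apply fun_interp_closed|].
    destruct (liftV _ Hargs) as (xs & Hxs & E & El).
    rewrite (iso_fun _ _ _ Hh), E by auto. rewrite El in Hs.
    eexists. split; [exact (generated_app _ _ _ _ _ Hs Hxs) | reflexivity]. }
  assert (Hmap : forall xs, (forall x, In x xs -> G x) ->
    Forall (universe A) (map f (map fst xs)) /\
    map h (map f (map fst xs)) = map snd xs).
  { intros xs Hxs. rewrite !map_map. split.
    - apply Forall_map_intro. intros x Hx. now apply Hf, Hxs.
    - apply map_ext_in. intros x Hx. now apply Hf, Hxs. }
  assert (Hiso : isomorphism (induced U cU) (induced V cV) f).
  { constructor; cbn [induced universe fun_interp rel_interp].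
    - intros a (x & Hx & ->). destruct (Hf x Hx). split; [assumption|]. now exists x.
    - intros a a' (x & Hx & ->) (y & Hy & ->) E.
      apply (tp_eq _ _ _ Hp); auto.
      destruct (Hf x Hx) as [_ <-], (Hf y Hy) as [_ <-]. congruence.
    - intros b (Hb & x & Hx & E). exists (fst x). split; [now exists x|].
      destruct (Hf x Hx) as [? E']. apply (iso_inj _ _ _ Hh); congruence.
    - intros s args Hs Hargs. destruct (liftU _ Hargs) as (xs & Hxs & -> & El).
      destruct (Hmap xs Hxs) as [HfA E].
      rewrite El in Hs.
      destruct (Hf _ (generated_app _ _ _ _ _ Hs Hxs)) as [Hv Ev]. cbn [fst snd] in *.
      apply (iso_inj _ _ _ Hh); auto.
      + apply fun_interp_closed; auto. now rewrite !length_map.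
      + rewrite (iso_fun _ _ _ Hh _ (map f (map fst xs))) by (auto; now rewrite !length_map).
        now rewrite E.
    - intros s args Hs Hargs. destruct (liftU _ Hargs) as (xs & Hxs & -> & El).
      destruct (Hmap xs Hxs) as [HfA E]. rewrite El in Hs.
      rewrite (tp_rel _ _ _ Hp) by auto.
      rewrite (iso_rel _ _ _ Hh _ (map f (map fst xs))) by (auto; now rewrite !length_map).
      now rewrite E. }
  destruct (hom _ _ f (induced_substructure U cU HUA) (induced_substructure V cV HVA))
    as (g & Hg & Hgf).
  - exists (map fst p). split.
    + apply Forall_map_intro. intros x Hx. exists x. split; [now constructor|easy].
    + intros T HT Hgens a (x & Hx & ->).
      rewrite Forall_map, Forall_forall in Hgens.
      induction Hx as [x Hx|s xs Hs Hxs IH]; auto. cbn [fst].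
      assert (HTxs : Forall (universe T) (map fst xs)) by now apply Forall_map_intro.
      rewrite <- (length_map fst) in Hs.
      pose proof (fun_interp_closed T s _ Hs HTxs) as Hcl.
      now rewrite (sub_fun _ _ HT) in Hcl.
  - exists (map f (map fst p)). split.
    + rewrite map_map. apply Forall_map_intro. intros x Hx.
      apply (iso_maps _ _ _ Hiso). exists x. split; [now constructor|easy].
    + intros T HT Hgens a Ha.
      destruct (iso_surj _ _ _ Hiso a Ha) as (a' & (x & Hx & ->) & <-). clear Ha.
      rewrite map_map, Forall_map, Forall_forall in Hgens.
      induction Hx as [x Hx|s xs Hs Hxs IH]; auto. cbn [fst].
      assert (HTxs : Forall (universe T) (map f (map fst xs))).
      { rewrite map_map. now apply Forall_map_intro. }
      assert (HUxs : Forall U (map fst xs)).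
      { apply Forall_map_intro. intros x Hx. exists x. split; [now apply Hxs|easy]. }
      rewrite <- (length_map fst) in Hs.
      pose proof (iso_fun _ _ _ Hiso s (map fst xs) Hs HUxs) as E.
      cbn [induced fun_interp] in E. rewrite E. clear E.
      rewrite <- (length_map f) in Hs.
      pose proof (fun_interp_closed T s _ Hs HTxs) as Hcl.
      now rewrite (sub_fun _ _ HT) in Hcl.
  - exact Hiso.
  - exists (fun a => h (g a)). split.
    + now apply (isomorphism_comp A A B).
    + intros x Hx.
      assert (HxG : G x) by now constructor.
      rewrite Hgf by now exists x. symmetry. now apply Hf.
Qed.

Lemma type_preserving_forth p a :
  ultrahomogeneous A -> isomorphic A B -> type_preserving A B p ->
  universe A a -> exists b, type_preserving A B ((a, b) :: p).
Proof.
  intros hom Hiso Hp Ha.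
  destruct (type_preserving_extends p hom Hiso Hp) as (g & Hg & Hpg).
  exists (g a). apply (isomorphism_type_preserving _ g Hg).
  intros x [<-|Hx]; [easy|]. split; [now apply (tp_universe _ _ _ Hp)|auto].
Qed.

Lemma type_preserving_back p b :
  ultrahomogeneous A -> isomorphic A B -> type_preserving A B p ->
  universe B b -> exists a, type_preserving A B ((a, b) :: p).
Proof.
  intros hom Hiso Hp Hb.
  destruct (type_preserving_extends p hom Hiso Hp) as (g & Hg & Hpg).
  destruct (iso_surj _ _ _ Hg b Hb) as (a & Ha & <-).
  exists a. apply (isomorphism_type_preserving _ g Hg).
  intros x [<-|Hx]; [easy|]. split; [now apply (tp_universe _ _ _ Hp)|auto].
Qed.

Lemma generated_mono p q x :
  incl p q -> generated A B p x -> generated A B q x.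
Proof.
  intros Hpq. induction 1; [constructor 1 | constructor 2]; auto.
Qed.

(** Every finite instance of the conditions for an isomorphism lives in a
    single member of the chain. *)
Lemma chain_isomorphism (chain : nat -> list (nat * nat)) (f : nat -> nat) :
  (forall k, type_preserving A B (chain k)) ->
  (forall k, incl (chain k) (chain (S k))) ->
  (forall a, universe A a -> exists k, In (a, f a) (chain k)) ->
  (forall b, universe B b -> exists k a, In (a, b) (chain k)) ->
  isomorphism A B f.
Proof.
  intros Htp Hincl Hforth Hback.
  assert (Hmono : forall j k, j <= k -> incl (chain j) (chain k)).
  { induction 1; [apply incl_refl|]. eapply incl_tran; eauto. }
  assert (Hargs : forall args, Forall (universe A) args ->
    exists k, forall a, In a args -> In (a, f a) (chain k)).
  { induction 1 as [|a args Ha _ [k Hk]]; [now exists 0|].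
    destruct (Hforth a Ha) as [j Hj]. exists (max j k).
    intros a' [<-|Ha']; [apply (Hmono j)|apply (Hmono k)]; auto; lia. }
  assert (Hinstance : forall args, Forall (universe A) args ->
    exists k, forall x, In x (map (fun a => (a, f a)) args) ->
      generated A B (chain k) x).
  { intros args Ha. destruct (Hargs args Ha) as [k Hk]. exists k.
    intros x Hx. apply in_map_iff in Hx. destruct Hx as (a & <- & Hin).
    constructor. auto. }
  assert (Hfst : forall args, map fst (map (fun a => (a, f a)) args) = args).
  { intros args. rewrite map_map. apply map_id. }
  assert (Hsnd : forall args, map snd (map (fun a => (a, f a)) args) = map f args).
  { intros args. now rewrite map_map. }
  constructor.
  - intros a Ha. destruct (Hforth a Ha) as [k Hk].
    exact (proj2 (tp_universe _ _ _ (Htp k) _ Hk)).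
  - intros a a' Ha Ha' E.
    destruct (Hinstance [a; a']) as [k Hk]; [now repeat constructor|].
    apply (tp_eq _ _ _ (Htp k) (a, f a) (a', f a')); [| |exact E]; apply Hk; simpl; auto.
  - intros b Hb. destruct (Hback b Hb) as (k & a & Hk).
    assert (Ha : universe A a) by exact (proj1 (tp_universe _ _ _ (Htp k) _ Hk)).
    exists a. split; [exact Ha|]. destruct (Hforth a Ha) as [j Hj].
    apply (tp_eq _ _ _ (Htp (max j k)) (a, f a) (a, b)); [| |reflexivity];
      constructor; [apply (Hmono j) | apply (Hmono k)]; auto; lia.
  - intros s args Hs Ha.
    destruct (Hinstance args Ha) as [k Hk].
    destruct (Hforth (fun_interp A s args)) as [j Hj]; [now apply fun_interp_closed|].
    rewrite <- (length_map (fun a => (a, f a))) in Hs.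
    pose proof (generated_app _ _ _ _ _ Hs Hk) as Happ. rewrite Hfst, Hsnd in Happ.
    apply (tp_eq _ _ _ (Htp (max j k)) (_, _) (_, _)
      (generated_in _ _ _ _ (Hmono j _ (Nat.le_max_l _ _) _ Hj))
      (generated_mono _ _ _ (Hmono k _ (Nat.le_max_r _ _)) Happ)).
    reflexivity.
  - intros s args Hs Ha.
    destruct (Hinstance args Ha) as [k Hk].
    rewrite <- (length_map (fun a => (a, f a))) in Hs.
    pose proof (tp_rel _ _ _ (Htp k) _ _ Hs Hk) as Hrel.
    now rewrite Hfst, Hsnd in Hrel.
Qed.
End Maps.

(** * Preservation of types is co-enumerable from the diagrams *)

Lemma atomic_diagram_literal {L : language} (A : structure L) l :
  atomic_diagram A (literal_num l) <-> wf_literal A l /\ literal_true A l.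
Proof.
  split.
  - intros (l' & E & Hl). apply literal_num_inj in E. now subst l'.
  - intros Hl. now exists l.
Qed.

Lemma wf_Elt_iff {L : language} (A : structure L) a : wf_term A (Elt a) <-> universe A a.
Proof.
  split; [|now constructor]. intros Hwf. now inversion Hwf.
Qed.

Lemma wf_map_Elt {L : language} (A : structure L) args :
  Forall (wf_term A) (map Elt args) <-> Forall (universe A) args.
Proof.
  rewrite Forall_map. split; apply Forall_impl; intros a; apply wf_Elt_iff.
Qed.

Lemma term_value_map_Elt {L : language} (A : structure L) args :
  map (term_value A) (map Elt args) = args.
Proof. rewrite map_map. apply map_id. Qed.

Definition value_fact {L : language} (A : structure L) (s : nat) (args : list nat) (a : nat) :
    Prop :=
  atomic_diagram A (literal_num (Pos (Eq (App s (map Elt args)) (Elt a)))).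

Definition rel_fact {L : language} (A : structure L) (s : nat) (args : list nat) : Prop :=
  atomic_diagram A (literal_num (Pos (Rel s (map Elt args)))).

Definition non_rel_fact {L : language} (A : structure L) (s : nat) (args : list nat) : Prop :=
  atomic_diagram A (literal_num (Neg (Rel s (map Elt args)))).

Lemma value_fact_iff {L : language} (A : structure L) s args a :
  value_fact A s args a <->
  fun_arity L s = Some (length args) /\ Forall (universe A) args /\ fun_interp A s args = a.
Proof.
  unfold value_fact. rewrite atomic_diagram_literal.
  cbn [wf_literal wf_atomic literal_true atomic_true term_value].
  rewrite wf_Elt_iff, term_value_map_Elt, <- wf_map_Elt, Forall_forall. split.
  - intros [[Hwf Ha] E]. inversion Hwf as [|? ? Hs Hargs]; subst.
    now rewrite length_map in Hs.
  - intros (Hs & Hargs & E). repeat split; auto.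
    + constructor; auto. now rewrite length_map.
    + subst a. apply fun_interp_closed; auto. now apply wf_map_Elt, Forall_forall.
Qed.

Lemma rel_fact_iff {L : language} (A : structure L) s args :
  rel_fact A s args <->
  rel_arity L s = Some (length args) /\ Forall (universe A) args /\ rel_interp A s args.
Proof.
  unfold rel_fact. rewrite atomic_diagram_literal.
  cbn [wf_literal wf_atomic literal_true atomic_true].
  rewrite wf_map_Elt, term_value_map_Elt, length_map. tauto.
Qed.

Lemma non_rel_fact_iff {L : language} (A : structure L) s args :
  non_rel_fact A s args <->
  rel_arity L s = Some (length args) /\ Forall (universe A) args /\ ~ rel_interp A s args.
Proof.
  unfold non_rel_fact. rewrite atomic_diagram_literal.
  cbn [wf_literal wf_atomic literal_true atomic_true].
  rewrite wf_map_Elt, term_value_map_Elt, length_map. tauto.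
Qed.

Lemma list_num_map_Elt args :
  list_num (map term_num (map Elt args)) = num (map (pair_num 0) args).
Proof. simpl. now rewrite !map_map. Qed.

Section Diagram.
Context {L : language} {A : structure L} {X : nat -> Prop}
  (HA : decidable_in X (atomic_diagram A)).

Lemma computable_elements {T} `{coded T} (f : T -> list nat) :
  computable_in X f ->
  computable_in X (fun t => list_num (map term_num (map Elt (f t)))).
Proof.
  intros Hf.
  apply (computable_ext (fun t => num (map (pair_num 0) (f t)))).
  - intros t. now rewrite list_num_map_Elt.
  - apply computable_num, computable_map; auto.
    apply computable_pair_num; prove_computable.
Qed.

Lemma decidable_universe {T} `{coded T} (f : T -> nat) :
  computable_in X f -> decidable_in X (fun t => universe A (f t)).
Proof.
  intros Hf.
  apply (decidable_ext (fun t => atomic_diagram A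
    (literal_num (Pos (Eq (Elt (f t)) (Elt (f t))))))).
  - intros t. rewrite atomic_diagram_literal. simpl. rewrite wf_Elt_iff. tauto.
  - apply (decidable_comp _ _ HA). simpl.
    repeat apply computable_pair_num; prove_computable.
Qed.

Lemma decidable_value_fact {T} `{coded T} (s : T -> nat) args a :
  computable_in X s -> computable_in X args -> computable_in X a ->
  decidable_in X (fun t => value_fact A (s t) (args t) (a t)).
Proof.
  intros. apply (decidable_comp _ _ HA). cbn [literal_num atomic_num term_num].
  repeat apply computable_pair_num; prove_computable.
  now apply computable_elements.
Qed.

Lemma decidable_rel_fact {T} `{coded T} (s : T -> nat) args :
  computable_in X s -> computable_in X args ->
  decidable_in X (fun t => rel_fact A (s t) (args t)).
Proof.
  intros. apply (decidable_comp _ _ HA). cbn [literal_num atomic_num term_num].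
  repeat apply computable_pair_num; prove_computable.
  now apply computable_elements.
Qed.

Lemma decidable_non_rel_fact {T} `{coded T} (s : T -> nat) args :
  computable_in X s -> computable_in X args ->
  decidable_in X (fun t => non_rel_fact A (s t) (args t)).
Proof.
  intros. apply (decidable_comp _ _ HA). cbn [literal_num atomic_num term_num].
  repeat apply computable_pair_num; prove_computable.
  now apply computable_elements.
Qed.
End Diagram.

Notation elements := (nat * nat)%type.
Notation application := (nat * list elements)%type.

Section Refutation.
Context {L : language} (A B : structure L).

Definition step_ok (known : list elements) (step : elements * application) : Prop :=
  Forall (fun y => In y known) (snd (snd step)) /\
  value_fact A (fst (snd step)) (map fst (snd (snd step))) (fst (fst step)) /\
  value_fact B (fst (snd step)) (map snd (snd (snd step))) (snd (fst step)).

(** Unjustified steps are skipped, so that every list of steps is a derivation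
    and no separate notion of a valid derivation is needed. *)
Definition take_step (known : list elements) (step : elements * application) :=
  if excluded_middle_informative (step_ok known step) then fst step :: known else known.

Definition derive (steps : list (elements * application)) (known : list elements) :=
  fold_left take_step steps known.

Lemma take_step_mono known known' step :
  incl known known' -> incl (take_step known step) (take_step known' step).
Proof.
  intros Hk. unfold take_step.
  destruct (excluded_middle_informative (step_ok known step)) as [[Hin Hv]|_].
  - destruct (excluded_middle_informative (step_ok known' step)) as [_|Hno].
    + intros x [<-|Hx]; [now left | right; auto].
    + destruct Hno. split; [|exact Hv]. eapply Forall_impl; [|exact Hin]. exact Hk.
  - by_cases; [now apply incl_tl | exact Hk].
Qed.

Lemma derive_mono steps known known' :
  incl known known' -> incl (derive steps known) (derive steps known').
Proof.
  revert known known'. induction steps as [|step steps IH]; intros known known' Hk;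
    simpl; [exact Hk|].
  now apply IH, take_step_mono.
Qed.

Lemma incl_derive steps known : incl known (derive steps known).
Proof.
  revert known. induction steps as [|step steps IH]; intros known; simpl.
  - apply incl_refl.
  - apply (incl_tran (m := take_step known step)); [|apply IH].
    unfold take_step. by_cases; [apply incl_tl|]; apply incl_refl.
Qed.

Lemma derive_sound p steps known :
  (forall x, In x known -> generated A B p x) ->
  forall x, In x (derive steps known) -> generated A B p x.
Proof.
  revert known. induction steps as [|step steps IH]; intros known Hk; [exact Hk|].
  apply IH. unfold take_step.
  destruct (excluded_middle_informative (step_ok known step)) as [(Hin & HvA & HvB)|_];
    [|exact Hk].
  intros x [<-|Hx]; [|auto].
  apply value_fact_iff in HvA, HvB. destruct HvA as (Hs & _ & EA), HvB as (_ & _ & EB).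
  rewrite length_map in Hs. rewrite Forall_forall in Hin.
  rewrite (surjective_pairing (fst step)), <- EA, <- EB.
  now apply generated_app; auto.
Qed.

(** Concatenating derivations loses nothing, by monotonicity. *)
Lemma derive_together p xs :
  (forall x, In x xs -> exists steps, In x (derive steps p)) ->
  exists steps, forall x, In x xs -> In x (derive steps p).
Proof.
  induction xs as [|x xs IH]; intros Hxs; [now exists []|].
  destruct IH as [steps Hsteps]; [intros; apply Hxs; now right|].
  destruct (Hxs x) as [steps' Hx]; [now left|].
  exists (steps ++ steps'). unfold derive. rewrite fold_left_app.
  intros y [<-|Hy].
  - eapply derive_mono; [|exact Hx]. apply incl_derive.
  - apply incl_derive. auto.
Qed.

Lemma derive_complete p x :
  (forall x, In x p -> universe A (fst x) /\ universe B (snd x)) ->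
  generated A B p x -> exists steps, In x (derive steps p).
Proof.
  intros Hp. induction 1 as [x Hx|s xs Hs Hxs IH]; [now exists []|].
  destruct (derive_together p xs IH) as [steps Hsteps].
  pose proof (fun y Hy => generated_universe A B p y Hp (Hxs y Hy)) as Hu.
  set (x := (fun_interp A s (map fst xs), fun_interp B s (map snd xs))).
  exists (steps ++ [(x, (s, xs))]). unfold derive. rewrite fold_left_app. simpl.
  unfold take_step at 1.
  destruct (excluded_middle_informative _) as [_|Hno]; [now left|].
  destruct Hno. split; [now apply Forall_forall|].
  split; apply value_fact_iff; rewrite length_map; repeat split; auto;
    apply Forall_map_intro; intros y Hy; now apply Hu.
Qed.

Notation witness :=
  (list (elements * application) * ((elements * elements) * application))%type.

(** A relation on which the columns differ has to be confirmed by a literal from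
    each diagram, as the mere absence of a positive literal would also occur for
    numbers that are no symbols and for lists of the wrong length. *)
Definition refutes (p : list elements) (w : witness) : Prop :=
  let known := derive (fst w) p in
  let x := fst (fst (snd w)) in
  let y := snd (fst (snd w)) in
  let s := fst (snd (snd w)) in
  let xs := snd (snd (snd w)) in
  (In x p /\ ~ (universe A (fst x) /\ universe B (snd x))) \/
  (In x known /\ In y known /\ ~ (fst x = fst y <-> snd x = snd y)) \/
  (Forall (fun z => In z known) xs /\
   ((rel_fact A s (map fst xs) /\ non_rel_fact B s (map snd xs)) \/
    (non_rel_fact A s (map fst xs) /\ rel_fact B s (map snd xs)))).

Lemma type_preserving_iff_irrefutable p :
  type_preserving A B p <-> ~ exists w, refutes p w.
Proof.
  split.
  - intros Hp [[steps [[x y] [s xs]]] Hw]. unfold refutes in Hw. cbn [fst snd] in Hw.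
    assert (Hgen : forall z, In z (derive steps p) -> generated A B p z).
    { apply derive_sound. now constructor. }
    destruct Hw as [[Hx Hno]|[(Hx & Hy & Hno)|[Hin Hw]]].
    + now apply Hno, (tp_universe _ _ _ Hp).
    + apply Hno, (tp_eq _ _ _ Hp); auto.
    + rewrite Forall_forall in Hin.
      rewrite !rel_fact_iff, !non_rel_fact_iff, length_map in Hw.
      assert (Hs : rel_arity L s = Some (length xs)) by tauto.
      pose proof (tp_rel _ _ _ Hp s xs Hs) as Hrel.
      assert (Hall : forall z, In z xs -> generated A B p z) by auto.
      tauto.
  - intros Hno.
    assert (Hp : forall x, In x p -> universe A (fst x) /\ universe B (snd x)).
    { intros x Hx. apply NNPP. intros Hu. apply Hno.
      (* Only the component relevant to the failure matters here and below; the
         others are filled with arbitrary values. *)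
      exists ([], ((x, x), (0, []))). now left. }
    constructor; [exact Hp| |].
    + intros x y Hx Hy. apply NNPP. intros Hu. apply Hno.
      destruct (derive_together p [x; y]) as [steps Hsteps].
      { intros z [<-|[<-|[]]]; now apply derive_complete. }
      exists (steps, ((x, y), (0, []))). right. left. cbn [fst snd].
      repeat split; auto; apply Hsteps; simpl; auto.
    + intros s xs Hs Hxs. apply NNPP. intros Hu. apply Hno.
      destruct (derive_together p xs) as [steps Hsteps].
      { intros z Hz. apply derive_complete; auto. }
      exists (steps, (((0, 0), (0, 0)), (s, xs))). right. right. cbn [fst snd].
      split; [now apply Forall_forall|].
      pose proof (fun y Hy => generated_universe A B p y Hp (Hxs y Hy)) as Hgen.
      assert (HA : Forall (universe A) (map fst xs)).
      { apply Forall_map_intro. intros y Hy. now apply Hgen. }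
      assert (HB : Forall (universe B) (map snd xs)).
      { apply Forall_map_intro. intros y Hy. now apply Hgen. }
      rewrite !rel_fact_iff, !non_rel_fact_iff, !length_map. tauto.
Qed.

Ltac prove_decidable :=
  repeat first
    [ assumption
    | lazymatch goal with
      | |- decidable_in _ (fun t => _ /\ _) => apply decidable_and
      | |- decidable_in _ (fun t => _ \/ _) => apply decidable_or
      | |- decidable_in _ (fun t => ~ _) => apply decidable_not
      | |- decidable_in _ (fun t => @?f t = @?g t) => apply (decidable_eq f g)
      | |- decidable_in _ (fun t => In (@?f t) (@?g t)) => apply (decidable_In f g)
      | H : decidable_in _ (atomic_diagram ?A)
        |- decidable_in _ (fun t => universe ?A (@?f t)) =>
          apply (decidable_universe H f)
      | H : decidable_in _ (atomic_diagram ?A)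
        |- decidable_in _ (fun t => value_fact ?A (@?f t) (@?g t) (@?h t)) =>
          apply (decidable_value_fact H f g h)
      | H : decidable_in _ (atomic_diagram ?A)
        |- decidable_in _ (fun t => rel_fact ?A (@?f t) (@?g t)) =>
          apply (decidable_rel_fact H f g)
      | H : decidable_in _ (atomic_diagram ?A)
        |- decidable_in _ (fun t => non_rel_fact ?A (@?f t) (@?g t)) =>
          apply (decidable_non_rel_fact H f g)
      | |- computable_in _ (fun t => map ?f (@?g t)) => apply (computable_map f g)
      end
    | computable_step ].

Context {X : nat -> Prop}
  (HA : decidable_in X (atomic_diagram A)) (HB : decidable_in X (atomic_diagram B)).

Lemma decidable_Forall_In {T V} `{coded T} `{coded V} (l known : T -> list V) :
  computable_in X l -> computable_in X known ->
  decidable_in X (fun t => Forall (fun x => In x (known t)) (l t)).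
Proof.
  intros Hl Hk.
  apply (decidable_Forall (fun t x => In x (known t))); auto.
  apply decidable_In; prove_computable.
  apply (computable_comp known); prove_computable.
Qed.

Lemma computable_derive {T} `{coded T} (steps : T -> list (elements * application)) known :
  computable_in X steps -> computable_in X known ->
  computable_in X (fun t => derive (steps t) (known t)).
Proof.
  intros Hs Hk. apply (computable_fold_left (fun _ => take_step)); auto.
  unfold take_step.
  apply (computable_if (fun z : T * (list elements * (elements * application)) =>
     step_ok (fst (snd z)) (snd (snd z)))).
  - unfold step_ok. prove_decidable.
    apply decidable_Forall_In; prove_computable.
  - apply computable_cons; prove_computable.
  - prove_computable.
Qed.

Lemma decidable_refutes :
  decidable_in X (fun z : list elements * witness => refutes (fst z) (snd z)).
Proof.
  assert (Hk : computable_in X (fun z : list elements * witness =>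
    derive (fst (snd z)) (fst z))).
  { apply computable_derive; prove_computable. }
  unfold refutes. cbn zeta. prove_decidable.
  - apply (decidable_ext (fun z : list elements * witness =>
      let x := fst (fst (snd (snd z))) in
      let y := snd (fst (snd (snd z))) in
      (fst x = fst y /\ snd x = snd y) \/ (~ fst x = fst y /\ ~ snd x = snd y))).
    + intros z. cbn zeta. tauto.
    + cbn zeta. prove_decidable.
  - apply decidable_Forall_In; prove_computable.
Qed.

Lemma type_preserving_decidable_jump :
  decidable_in (jump X) (type_preserving A B).
Proof.
  apply (decidable_ext (fun p => ~ exists w, refutes p w)).
  - intros p. symmetry. apply type_preserving_iff_irrefutable.
  - apply decidable_not, decidable_exists_jump, decidable_refutes.
Qed.
End Refutation.

(** * The back-and-forth construction *)

Lemma computable_double {X : nat -> Prop} : computable_in X (fun n => 2 * n).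
Proof.
  apply (computable_ext (fun n =>
    nat_rect (fun _ => nat) 0 (fun k u => S (S (snd (snd (n, (k, u)))))) n)).
  - intros n. induction n as [|n IH]; cbn [nat_rect snd] in *; lia.
  - apply (computable_nat_rec (fun n => n) (fun _ => 0) (fun z => S (S (snd (snd z)))));
      prove_computable.
Qed.

Lemma decidable_join_l Y Z : decidable_in (join Y Z) Y.
Proof.
  apply (decidable_ext (fun n => join Y Z (2 * n))).
  - intros n. unfold join. rewrite Nat.even_even, Nat.div2_double. reflexivity.
  - apply decidable_oracle, computable_double.
Qed.

Lemma decidable_join_r Y Z : decidable_in (join Y Z) Z.
Proof.
  apply (decidable_ext (fun n => join Y Z (S (2 * n)))).
  - intros n. unfold join. rewrite <- Nat.add_1_r, Nat.even_odd, Nat.add_1_r.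
    now rewrite Nat.div2_succ_double.
  - apply decidable_oracle, computable_S, computable_double.
Qed.

(** Divergence off [D] comes from a search whose condition is membership in [D],
    independently of the number searched for. *)
Lemma partial_computable_restrict {X : nat -> Prop} (D : nat -> Prop) (f : nat -> nat) :
  decidable_in X D -> computable_in X f ->
  partial_computable_in X (fun a b => D a /\ b = f a).
Proof.
  intros HD [c Hc].
  destruct (eval_Mu_decidable (X := X) (fun a _ => D a)) as [d Hd].
  { apply (decidable_comp D); prove_computable. }
  exists (Comp Snd (Pair d c)). intros a b. cbn [eval]. split.
  - intros (m & (u & v & Hu & Hv & ->) & ->).
    apply (Hd a) in Hu. apply (Hc a) in Hv. now rewrite snd_pair_num.
  - intros [Ha ->]. exists (pair_num 0 (f a)). rewrite snd_pair_num.
    split; [|reflexivity]. exists 0, (f a). repeat split.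
    + apply (Hd a). split; [exact Ha | lia].
    + now apply (Hc a).
Qed.

(** One direction of a back-and-forth step: [d] is the element to be treated,
    [pt d n] the pair formed from it and a candidate partner [n]. Outside the
    case of interest the search is made to succeed at once, so that it is total. *)
Lemma computable_partner {X : nat -> Prop} (P : list elements -> Prop) (D : nat -> Prop)
    (pt : nat -> nat -> elements) :
  decidable_in X P -> decidable_in X D ->
  computable_in X (fun z : nat * nat => pt (fst z) (snd z)) ->
  (forall p d, P p -> D d -> exists n, P (pt d n :: p)) ->
  exists partner : list elements * nat -> nat,
    computable_in X partner /\
    computable_in X (fun t => if excluded_middle_informative (D (snd t))
      then pt (snd t) (partner t) :: fst t else fst t) /\
    forall p d, P p -> D d -> P (pt d (partner (p, d)) :: p).
Proof.
  intros HP HD Hpt Hex.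
  assert (HDt : decidable_in X (fun t : list elements * nat => D (snd t))).
  { apply (decidable_comp D); prove_computable. }
  destruct (computable_search (X := X) (fun (t : list elements * nat) n =>
    ~ (P (fst t) /\ D (snd t)) \/ P (pt (snd t) n :: fst t)))
    as (partner & Hpartner & partner_spec).
  { apply decidable_or; [apply decidable_not, decidable_and|].
    - apply (decidable_comp P); prove_computable.
    - apply (decidable_comp D); prove_computable.
    - apply (decidable_comp P); auto. apply computable_cons; prove_computable.
      apply (computable_comp (fun z => pt (fst z) (snd z))
        (fun z : list elements * nat * nat => (snd (fst z), snd z)) Hpt).
      prove_computable. }
  { intros [p d]. cbn [fst snd].
    destruct (classic (P p /\ D d)) as [[Hp Hd]|Hno].
    - destruct (Hex p d Hp Hd) as [n Hn]. exists n. now right.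
    - exists 0. now left. }
  exists partner. repeat split; auto.
  - apply computable_if; prove_computable. apply computable_cons; prove_computable.
    apply (computable_comp (fun z => pt (fst z) (snd z))
      (fun t : list elements * nat => (snd t, partner t)) Hpt).
    prove_computable.
  - intros p d Hp Hd. destruct (partner_spec (p, d)) as [Hno|Hok]; [|exact Hok].
    now destruct Hno.
Qed.

(** The partner given to [a] at stage [a] is the value of the isomorphism there,
    since later stages only lengthen the list. *)
Lemma back_and_forth {L : language} (A B : structure L) (X : nat -> Prop) :
  ultrahomogeneous A -> isomorphic A B ->
  decidable_in X (universe A) -> decidable_in X (universe B) ->
  decidable_in X (type_preserving A B) ->
  exists f, isomorphism A B f /\ computable_in X f.
Proof.
  intros hom Hiso HA HB Htp.
  destruct (computable_partner (X := X) (type_preserving A B) (universe A)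
    (fun a n => (a, n))) as (forth & Hforth & Hadd_forth & forth_spec); auto.
  { prove_computable. }
  { intros p a. now apply type_preserving_forth. }
  destruct (computable_partner (X := X) (type_preserving A B) (universe B)
    (fun b n => (n, b))) as (back & Hback & Hadd_back & back_spec); auto.
  { prove_computable. }
  { intros p b. now apply type_preserving_back. }
  set (add_forth := fun t : list elements * nat =>
    if excluded_middle_informative (universe A (snd t))
    then (snd t, forth t) :: fst t else fst t) in *.
  set (add_back := fun t : list elements * nat =>
    if excluded_middle_informative (universe B (snd t))
    then (back t, snd t) :: fst t else fst t) in *.
  assert (add_forth_tp : forall p a, type_preserving A B p ->
    type_preserving A B (add_forth (p, a))).
  { intros p a Hp. unfold add_forth. cbn [fst snd]. by_cases; auto. }
  assert (add_back_tp : forall p b, type_preserving A B p ->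
    type_preserving A B (add_back (p, b))).
  { intros p b Hp. unfold add_back. cbn [fst snd]. by_cases; auto. }
  assert (add_forth_incl : forall p a, incl p (add_forth (p, a))).
  { intros p a. unfold add_forth. cbn [fst snd].
    by_cases; [apply incl_tl|]; apply incl_refl. }
  assert (add_back_incl : forall p b, incl p (add_back (p, b))).
  { intros p b. unfold add_back. cbn [fst snd].
    by_cases; [apply incl_tl|]; apply incl_refl. }
  (* Stage [k] puts [k] into the domain and then into the range, wherever it
     belongs to the universe concerned. *)
  pose (chain := fun n => nat_rect (fun _ => list elements) []
    (fun k p => add_back (add_forth (p, k), k)) n).
  assert (Hchain : computable_in X chain).
  { apply (computable_nat_rec (fun n : nat => n) (fun _ => [])
      (fun z : nat * (nat * list elements) =>
         add_back (add_forth (snd (snd z), fst (snd z)), fst (snd z)))); prove_computable.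
    apply (computable_comp add_back); prove_computable.
    apply (computable_comp add_forth); prove_computable. }
  exists (fun a => forth (chain a, a)). split.
  - apply (chain_isomorphism A B chain).
    + intros k. induction k as [|k IH].
      * destruct Hiso as [h Hh]. apply (isomorphism_type_preserving A B _ h Hh).
        intros x [].
      * now apply add_back_tp, add_forth_tp.
    + intros k. exact (incl_tran (add_forth_incl _ k) (add_back_incl _ k)).
    + intros a Ha. exists (S a). apply add_back_incl. unfold add_forth. cbn [fst snd].
      by_cases; [now left | easy].
    + intros b Hb. exists (S b), (back (add_forth (chain b, b), b)).
      change (chain (S b)) with (add_back (add_forth (chain b, b), b)).
      unfold add_back at 1. cbn [fst snd]. by_cases; [now left | easy].
  - apply (computable_comp forth); prove_computable.
Qed.

Theorem theorem2p3 (L : language) (HL : computable_language L)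
  (A : structure L) (hom : ultrahomogeneous A) :
  relatively_delta02_categorical A.
Proof.
  intros B Hiso.
  set (X := join (atomic_diagram A) (atomic_diagram B)).
  assert (HA : decidable_in X (atomic_diagram A)) by apply decidable_join_l.
  assert (HB : decidable_in X (atomic_diagram B)) by apply decidable_join_r.
  assert (HuA : decidable_in (jump X) (universe A)).
  { apply decidable_jump, (decidable_universe HA (fun a => a)). prove_computable. }
  assert (HuB : decidable_in (jump X) (universe B)).
  { apply decidable_jump, (decidable_universe HB (fun b => b)). prove_computable. }
  destruct (back_and_forth A B (jump X) hom Hiso HuA HuB) as (f & Hf & Hfc).
  { now apply type_preserving_decidable_jump. }
  exists f. split; [exact Hf|]. now apply partial_computable_restrict.
Qed.
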